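(* Let $A=\mathrm{Mat}(N,\mathbb{C})$. All nondegenerate unitary solutions $r(u)\in A\otimes A$ of the equation $$r^{12}(-u')r^{13}(u+u')-r^{23}(u+u')r^{12}(u)+r^{13}(u)r^{23}(u')=0$$ have the form $$r(u)=(\phi_a(cu)\otimes\mathrm{id})(P),$$ where $c\in\mathbb{C}^*$, $a\in\mathfrak{sl}_N$, and $\phi_a(u)\in\mathrm{End}(A)$ is the linear operator on $A$ defined from the equation $$u\,\phi_a(u)(X)+[a,\phi_a(u)(X)]=X\qquad (X\in A).$$
   Context: $r(u)$ is a meromorphic $A\otimes A$-valued function in a neighborhood of $0\in\mathbb{C}$; it is nondegenerate if the tensor $r(u)$ is nondegenerate for generic $u$, and unitary if $r^{21}(-u)=-r(u)$, where $r^{21}$ is $r$ with tensor factors exchanged. Here $r^{12}=r\otimes 1\in A\otimes A\otimes A$, and $r^{13},r^{23}$ are defined similarly. $P=\sum_{i,j}e_{ij}\otimes e_{ji}$, where $e_{ij}$ are the matrix units. *)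

(* Defs.v *)
From HB Require Import structures.
From mathcomp Require Import all_boot all_order all_algebra.
From mathcomp Require Import all_classical all_reals all_analysis.
From mathcomp Require Import complex mxtens.

Set Implicit Arguments.
Unset Strict Implicit.
Unset Printing Implicit Defensive.

Import Order.TTheory GRing.Theory Num.Theory.
Import numFieldNormedType.Exports.

Local Open Scope classical_set_scope.
Local Open Scope ring_scope.

(* R[i] has no topology of its own in MathComp-Analysis; seen through
   numClosedFieldType it receives the one given by its modulus. *)
Definition Cplx (R : realType) : numClosedFieldType := R[i].

(* Poles are allowed, and the value of f at z itself is irrelevant. *)
Definition meromorphic_at (R : realType) (f : Cplx R -> Cplx R) (z : Cplx R) :
    Prop :=
  exists (k : nat) (g : Cplx R -> (Cplx R)^o),
    (\forall w \near z, derivable (g : (Cplx R)^o -> (Cplx R)^o) w 1) /\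
    (\forall w \near z^', f w = (w - z) ^- k * g w).

Definition meromorphic_near0 (R : realType) (m n : nat)
    (f : Cplx R -> 'M[Cplx R]_(m, n)) : Prop :=
  forall i j, \forall z \near (0 : Cplx R), meromorphic_at (fun u => f u i j) z.

(* For A = 'M_N, the tensor product of algebras A (x) A is 'M_(N * N), with
   x (x) y the Kronecker product x *t y, and A (x) A (x) A is 'M_(N * N * N),
   with x (x) y (x) z the product x *t y *t z. *)

(* The coefficient of t on e_ij (x) e_kl. *)
Definition tcoef (F : fieldType) (N : nat) (t : 'M[F]_(N * N))
    (i j k l : 'I_N) : F :=
  t (mxtens_index (i, k)) (mxtens_index (j, l)).

(* The linear map on A (x) A induced by a bilinear map h on A x A. *)
Definition tlift (F : fieldType) (N : nat) (V : lmodType F)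
    (h : 'M[F]_N -> 'M[F]_N -> V) (t : 'M[F]_(N * N)) : V :=
  \sum_i \sum_j \sum_k \sum_l
    tcoef t i j k l *: h (delta_mx i j) (delta_mx k l).

Lemma tlift_tens (F : fieldType) (N : nat) (V : lmodType F)
    (h : 'M[F]_N -> 'M[F]_N -> V) :
    (forall y, linear (h^~ y)) -> (forall x, linear (h x)) ->
  forall x y, tlift h (x *t y) = h x y.
Proof.
move=> hl hr x y.
pose L y := GRing.isLinear.Build _ _ _ _ (h^~ y) (hl y).
pose hL y : {linear _ -> _} := HB.pack (h^~ y) (L y).
pose K x := GRing.isLinear.Build _ _ _ _ (h x) (hr x).
pose hR x : {linear _ -> _} := HB.pack (h x) (K x).
rewrite {2}(matrix_sum_delta x) -[RHS]/(hL y _) linear_sum.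
apply: eq_bigr => i _; rewrite linear_sum; apply: eq_bigr => j _.
rewrite linearZ [RHS]/= {2}(matrix_sum_delta y) -[h _ _]/(hR _ _).
rewrite linear_sum scaler_sumr; apply: eq_bigr => k _.
rewrite linear_sum scaler_sumr; apply: eq_bigr => l _.
by rewrite linearZ scalerA /tcoef tensmxE.
Qed.

Definition tens12 (F : fieldType) (N : nat) (t : 'M[F]_(N * N)) :
    'M[F]_(N * N * N) :=
  tlift (fun x y => x *t y *t (1%:M : 'M[F]_N)) t.

Definition tens13 (F : fieldType) (N : nat) (t : 'M[F]_(N * N)) :
    'M[F]_(N * N * N) :=
  tlift (fun x y => x *t (1%:M : 'M[F]_N) *t y) t.

Definition tens23 (F : fieldType) (N : nat) (t : 'M[F]_(N * N)) :
    'M[F]_(N * N * N) :=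
  tlift (fun x y => (1%:M : 'M[F]_N) *t x *t y) t.

Definition tens21 (F : fieldType) (N : nat) (t : 'M[F]_(N * N)) :
    'M[F]_(N * N) :=
  tlift (fun x y => y *t x) t.

Definition tens_map_l (F : fieldType) (N : nat) (phi : 'End('M[F]_N))
    (t : 'M[F]_(N * N)) : 'M[F]_(N * N) :=
  tlift (fun x y => phi x *t y) t.

Definition tensP (F : fieldType) (N : nat) : 'M[F]_(N * N) :=
  \sum_(i < N) \sum_(j < N) delta_mx i j *t delta_mx j i.

(* The map A^* -> A, xi |-> (xi (x) id)(t), is an isomorphism. *)
Definition nondegenerate_tensor (F : fieldType) (N : nat)
    (t : 'M[F]_(N * N)) : Prop :=
  bijective (fun xi : 'Hom('M[F]_N, F^o) =>
    tlift (fun x y => (xi x : F) *: y) t : 'M[F]_N).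

(* Genericity of u is taken in the sense of germs at 0: the degeneracy locus
   of a meromorphic r is either everything or avoids a punctured disc. *)
Definition generically_nondegenerate (R : realType) (N : nat)
    (r : Cplx R -> 'M[Cplx R]_(N * N)) : Prop :=
  \forall u \near (0 : Cplx R)^', nondegenerate_tensor (r u).

Definition unitary_rmatrix (R : realType) (N : nat)
    (r : Cplx R -> 'M[Cplx R]_(N * N)) : Prop :=
  \forall u \near (0 : Cplx R)^', tens21 (r (- u)) = - r u.

(* An identity of meromorphic functions of (u, u') near (0, 0), hence required
   away from the polar locus u u' (u + u') = 0. *)
Definition associative_YBE (R : realType) (N : nat)
    (r : Cplx R -> 'M[Cplx R]_(N * N)) : Prop :=
  \forall p \near ((0, 0) : Cplx R * Cplx R),
    let u := p.1 in let u' := p.2 in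
    u != 0 -> u' != 0 -> u + u' != 0 ->
    tens12 (r (- u')) *m tens13 (r (u + u'))
    - tens23 (r (u + u')) *m tens12 (r u)
    + tens13 (r u) *m tens23 (r u') = 0.

(* phi is phi_a(u). The equation makes phi a right inverse of the endomorphism
   u + ad a of the finite-dimensional space A, so it determines phi. *)
Definition is_phi (F : fieldType) (N : nat) (a : 'M[F]_N) (u : F)
    (phi : 'End('M[F]_N)) : Prop :=
  forall X : 'M[F]_N, u *: phi X + (a *m phi X - phi X *m a) = X.

(* Main.v *)
Require Import Defs.
From HB Require Import structures.
From mathcomp Require Import all_boot all_order all_algebra.
From mathcomp Require Import all_classical all_reals all_analysis.
From mathcomp Require Import complex mxtens.

Import Order.TTheory GRing.Theory Num.Theory.
Import numFieldNormedType.Exports.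

Local Open Scope classical_set_scope.
Local Open Scope ring_scope.

(** Contracting the second leg of r(u) with the trace form turns it into an
operator phi_u(X) = (id (x) tr)(r(u) (1 (x) X)) on A = Mat(N), from which r(u)
is recovered as (phi_u (x) id)(P).  Contracting the last two legs of the
associative Yang-Baxter equation, and using unitarity to rewrite the term in
which the adjoint of phi appears, gives (AYBE_tensor_op)
  phi_x(X) phi_y(Y) = phi_{x+y}(X phi_y(Y) + phi_x(X) Y).

Nondegeneracy makes phi_u invertible, and for D_u = phi_u^-1 the equation
becomes a Leibniz rule with a varying parameter,
  D_{x+y}(S T) = D_x(S) T + S D_y(T).
Taking S = 1 and then T = 1 shows that D_y(1) commutes with every matrix, so
D_y(1) = f(y) 1 with f additive near 0, and that D_u - f(u) does not depend
on u.  This constant operator is a derivation of A, hence an inner one, ad a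
with tr a = 0 (twisted_derivation).  So D_u = f(u) + ad a.

It remains to see that f is linear.  Since f(u) phi_u(1) = 1, the function f is
the inverse of a matrix coefficient of r, which is meromorphic, hence f has a
complex derivative c at some point.  By additivity the difference quotient of f
at that point is f(h) / h, and f(h) / h does not change when h is halved, so
f(u) = c u (additive_derivable_linear).  Finally c <> 0 because f(u) is
invertible. *)

Set Implicit Arguments.
Unset Strict Implicit.
Unset Printing Implicit Defensive.

(** * The tensor square of the matrix algebra *)

Lemma tlift_is_linear (F : fieldType) (N : nat) (V : lmodType F)
  (h : 'M[F]_N -> 'M[F]_N -> V) : linear (tlift h).
Proof.
move=> a t s; rewrite /tlift scaler_sumr -big_split; apply: eq_bigr => i _ /=.
rewrite scaler_sumr -big_split; apply: eq_bigr => j _ /=.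
rewrite scaler_sumr -big_split; apply: eq_bigr => k _ /=.
rewrite scaler_sumr -big_split; apply: eq_bigr => l _ /=.
by rewrite /tcoef !mxE scalerDl scalerA.
Qed.

HB.instance Definition _ (F : fieldType) (N : nat) (V : lmodType F)
  (h : 'M[F]_N -> 'M[F]_N -> V) :=
  GRing.isLinear.Build _ _ _ _ (tlift h) (@tlift_is_linear F N V h).

Lemma tensmx_linearl (F : fieldType) (m n p q : nat) (y : 'M[F]_(p, q)) :
  linear (fun x : 'M[F]_(m, n) => x *t y).
Proof. by move=> a x x'; apply/matrixP => i j; rewrite !mxE mulrDl mulrA. Qed.

Lemma tensmx_linearr (F : fieldType) (m n p q : nat) (x : 'M[F]_(m, n)) :
  linear (fun y : 'M[F]_(p, q) => x *t y).
Proof.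
by move=> a y y'; apply/matrixP => i j; rewrite !mxE mulrDr mulrCA.
Qed.

Lemma tensmxZl (F : fieldType) (m n p q : nat) a (x : 'M[F]_(m, n))
  (y : 'M[F]_(p, q)) : (a *: x) *t y = a *: (x *t y).
Proof. by apply/matrixP => i j; rewrite !mxE mulrA. Qed.

Lemma tensmx_sum_delta (F : fieldType) (N : nat) (t : 'M[F]_(N * N)) :
  t = \sum_i \sum_j \sum_k \sum_l
        tcoef t i j k l *: (delta_mx i j *t delta_mx k l).
Proof.
apply/matrixP => p q.
case: p / (mxtens_indexP p) => i0 k0; case: q / (mxtens_indexP q) => j0 l0.
have E i j k l : (tcoef t i j k l *: (delta_mx i j *t delta_mx k l))
    (mxtens_index (i0, k0)) (mxtens_index (j0, l0))
    = tcoef t i j k l * ((i0 == i) && (j0 == j))%:R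
        * ((k0 == k) && (l0 == l))%:R.
  by rewrite mxE tensmxE !mxE mulrA.
rewrite summxE (bigD1 i0) //= [X in _ + X]big1 ?addr0; last first.
  move=> i /negPf ni; rewrite summxE big1 // => j _.
  rewrite summxE big1 // => k _; rewrite summxE big1 // => l _.
  by rewrite E eq_sym ni mulr0 mul0r.
rewrite summxE (bigD1 j0) //= [X in _ + X]big1 ?addr0; last first.
  move=> j /negPf nj; rewrite summxE big1 // => k _.
  rewrite summxE big1 // => l _.
  by rewrite E [j0 == j]eq_sym nj andbF mulr0 mul0r.
rewrite summxE (bigD1 k0) //= [X in _ + X]big1 ?addr0; last first.
  move=> k /negPf nk; rewrite summxE big1 // => l _.
  by rewrite E [k0 == k]eq_sym nk mulr0.
rewrite summxE (bigD1 l0) //= [X in _ + X]big1 ?addr0; last first.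
  by move=> l /negPf nl; rewrite E [l0 == l]eq_sym nl andbF mulr0.
by rewrite E !eqxx !mulr1.
Qed.

(** Simple tensors span, so an additive property of tensors need only be
checked on them. *)
Lemma tensmx_ind (F : fieldType) (N : nat) (Q : 'M[F]_(N * N) -> Prop) :
  Q 0 -> (forall t s, Q t -> Q s -> Q (t + s)) ->
  (forall x y : 'M[F]_N, Q (x *t y)) -> forall t, Q t.
Proof.
move=> Q0 QD Qt t; rewrite (tensmx_sum_delta t).
do 4![apply: big_ind => // ? _].
by rewrite -tensmxZl.
Qed.

Lemma tens12E (F : fieldType) (N : nat) (x y : 'M[F]_N) :
  tens12 (x *t y) = x *t y *t (1%:M : 'M[F]_N).
Proof.
by apply: tlift_tens => z a u v; rewrite ?tensmx_linearl ?tensmx_linearr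
   ?tensmx_linearl.
Qed.

Lemma tens13E (F : fieldType) (N : nat) (x y : 'M[F]_N) :
  tens13 (x *t y) = x *t (1%:M : 'M[F]_N) *t y.
Proof.
by apply: tlift_tens => z a u v; rewrite ?tensmx_linearl ?tensmx_linearr
   ?tensmx_linearl.
Qed.

Lemma tens23E (F : fieldType) (N : nat) (x y : 'M[F]_N) :
  tens23 (x *t y) = (1%:M : 'M[F]_N) *t x *t y.
Proof.
by apply: tlift_tens => z a u v; rewrite ?tensmx_linearl ?tensmx_linearr
   ?tensmx_linearl.
Qed.

Lemma tens21E (F : fieldType) (N : nat) (x y : 'M[F]_N) :
  tens21 (x *t y) = y *t x.
Proof.
by apply: tlift_tens => z a u v; rewrite ?tensmx_linearl ?tensmx_linearr
   ?tensmx_linearl.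
Qed.

(** The contraction (id (x) tr)(t (1 (x) X)) of the second leg of t. *)
Definition partial_trace (F : fieldType) (N : nat) (t : 'M[F]_(N * N))
    (X : 'M[F]_N) : 'M[F]_N :=
  tlift (fun x y => \tr (y *m X) *: x) t.

Lemma partial_traceE (F : fieldType) (N : nat) (x y X : 'M[F]_N) :
  partial_trace (x *t y) X = \tr (y *m X) *: x.
Proof.
apply: (@tlift_tens F N 'M[F]_N (fun x y => \tr (y *m X) *: x)) => z a u v.
  by rewrite scalerDr !scalerA mulrC.
by rewrite mulmxDl -scalemxAl mxtraceD mxtraceZ scalerDl scalerA.
Qed.

Lemma partial_traceD (F : fieldType) (N : nat) (t s : 'M[F]_(N * N)) X :
  partial_trace (t + s) X = partial_trace t X + partial_trace s X.
Proof. exact: linearD. Qed.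

Lemma partial_trace_is_linear (F : fieldType) (N : nat) (t : 'M[F]_(N * N)) :
  linear (partial_trace t).
Proof.
move=> a X Y; elim/tensmx_ind: t => [|t s IHt IHs|x y].
- by rewrite /partial_trace !linear0 ?scaler0 addr0.
- by rewrite !partial_traceD IHt IHs scalerDr addrACA.
- rewrite !partial_traceE mulmxDr -scalemxAr mxtraceD mxtraceZ.
  by rewrite scalerDl scalerA.
Qed.

HB.instance Definition _ (F : fieldType) (N : nat) (t : 'M[F]_(N * N)) :=
  GRing.isLinear.Build _ _ _ _ (partial_trace t)
    (@partial_trace_is_linear F N t).

(** The operator on A attached to a tensor by identifying A with its dual
through the trace form; the tensor P corresponds to the identity. *)
Definition tensor_op (F : fieldType) (N : nat) (t : 'M[F]_(N * N)) :
    'End('M[F]_N) := linfun (partial_trace t).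

Lemma tensor_opE (F : fieldType) (N : nat) (x y X : 'M[F]_N) :
  tensor_op (x *t y) X = \tr (y *m X) *: x.
Proof. by rewrite lfunE /= partial_traceE. Qed.

Lemma tensor_opD (F : fieldType) (N : nat) (t s : 'M[F]_(N * N)) X :
  tensor_op (t + s) X = tensor_op t X + tensor_op s X.
Proof. by rewrite !lfunE /= partial_traceD. Qed.

Lemma tensor_opN (F : fieldType) (N : nat) (t : 'M[F]_(N * N)) X :
  tensor_op (- t) X = - tensor_op t X.
Proof. by rewrite !lfunE /= /partial_trace linearN. Qed.

Lemma tensor_op0 (F : fieldType) (N : nat) X :
  tensor_op (0 : 'M[F]_(N * N)) X = 0.
Proof. by rewrite lfunE /= /partial_trace linear0. Qed.

Lemma mxtrace_mul_delta (F : fieldType) (N : nat) (X : 'M[F]_N) i j :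
  \tr (delta_mx i j *m X) = X j i.
Proof.
rewrite /mxtrace (bigD1 i) //= [X in _ + X]big1 ?addr0.
  rewrite mxE (bigD1 j) //= mxE !eqxx mul1r big1 ?addr0 // => k /negPf nk.
  by rewrite mxE nk andbF mul0r.
move=> k /negPf nk; rewrite mxE big1 // => l _.
by rewrite mxE nk mul0r.
Qed.

Lemma tens_map_l_tensor_op (F : fieldType) (N : nat) (t : 'M[F]_(N * N)) :
  tens_map_l (tensor_op t) (tensP F N) = t.
Proof.
have tlin (phi : 'End('M[F]_N)) (x y : 'M[F]_N) :
    tens_map_l phi (x *t y) = phi x *t y.
  apply: (@tlift_tens F N 'M[F]_(N * N) (fun x y => phi x *t y)) => z a u v.
    by rewrite linearP tensmx_linearl.
  by rewrite tensmx_linearr.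
have -> : tens_map_l (tensor_op t) (tensP F N)
    = \sum_i \sum_j tensor_op t (delta_mx i j) *t delta_mx j i.
  rewrite /tensP /tens_map_l linear_sum; apply: eq_bigr => i _.
  by rewrite linear_sum; apply: eq_bigr => j _; apply: tlin.
elim/tensmx_ind: t => [|t s IHt IHs|x y].
- rewrite big1 // => i _; rewrite big1 // => j _.
  by rewrite tensor_op0 tens0mx.
- rewrite -[in RHS]IHt -[in RHS]IHs -big_split; apply: eq_bigr => i _ /=.
  rewrite -big_split; apply: eq_bigr => j _ /=.
  rewrite tensor_opD.
  by have := tensmx_linearl (delta_mx j i) 1 (tensor_op t (delta_mx i j))
    (tensor_op s (delta_mx i j)); rewrite !scale1r.
- rewrite [in RHS](matrix_sum_delta y) exchange_big /=.
  apply/matrixP => p q; case: p / (mxtens_indexP p) => p p'.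
  case: q / (mxtens_indexP q) => q q'.
  rewrite tensmxE !summxE mulr_sumr; apply: eq_bigr => i _.
  rewrite !summxE mulr_sumr; apply: eq_bigr => j _.
  rewrite tensmxE tensor_opE mxtrace_mulC mxtrace_mul_delta.
  by rewrite !mxE mulrCA mulrA.
Qed.

(** The contraction (id (x) tr (x) tr)(M (1 (x) X (x) Y)) of the last two legs,
written on coefficients. *)
Definition partial_trace23 (F : fieldType) (N : nat) (X Y : 'M[F]_N)
    (M : 'M[F]_(N * N * N)) : 'M[F]_N :=
  \matrix_(i, j) \sum_k \sum_l \sum_m \sum_n
     M (mxtens_index (mxtens_index (i, k), m))
       (mxtens_index (mxtens_index (j, l), n)) * (X l k * Y n m).

Lemma partial_trace23_is_linear (F : fieldType) (N : nat) (X Y : 'M[F]_N) :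
  linear (partial_trace23 X Y).
Proof.
move=> a t s; apply/matrixP => i j; rewrite !mxE mulr_sumr -big_split.
apply: eq_bigr => k _ /=; rewrite mulr_sumr -big_split.
apply: eq_bigr => l _ /=; rewrite mulr_sumr -big_split.
apply: eq_bigr => m _ /=; rewrite mulr_sumr -big_split.
apply: eq_bigr => n _ /=.
by rewrite !mxE mulrDl -mulrA.
Qed.

HB.instance Definition _ (F : fieldType) (N : nat) (X Y : 'M[F]_N) :=
  GRing.isLinear.Build _ _ _ _ (partial_trace23 X Y)
    (@partial_trace23_is_linear F N X Y).

Lemma partial_trace23E (F : fieldType) (N : nat) (X Y x y z : 'M[F]_N) :
  partial_trace23 X Y (x *t y *t z) = (\tr (y *m X) * \tr (z *m Y)) *: x.
Proof.
apply/matrixP => i j; rewrite !mxE /mxtrace !mulr_suml.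
apply: eq_bigr => k _; rewrite [in RHS]mxE !mulr_suml.
apply: eq_bigr => l _; rewrite mulr_sumr mulr_suml.
apply: eq_bigr => m _; rewrite [in RHS]mxE mulr_sumr mulr_suml.
apply: eq_bigr => n _.
by rewrite !tensmxE -!mulrA mulrCA; congr (_ * _); rewrite mulrC -!mulrA
  mulrCA; congr (_ * _); rewrite mulrCA.
Qed.

(** The contractions of the three terms of the associative Yang-Baxter
equation. *)
Lemma partial_trace23_12_13 (F : fieldType) (N : nat) (t s : 'M[F]_(N * N))
    (X Y : 'M[F]_N) :
  partial_trace23 X Y (tens12 t *m tens13 s) = tensor_op t X *m tensor_op s Y.
Proof.
elim/tensmx_ind: t => [|t t' IHt IHt'|x y].
- by rewrite /tens12 linear0 mul0mx linear0 tensor_op0 mul0mx.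
- rewrite tensor_opD mulmxDl -IHt -IHt' -linearD -mulmxDl.
  by rewrite /tens12 -linearD.
elim/tensmx_ind: s => [|s s' IHs IHs'|x' y'].
- by rewrite /tens13 linear0 mulmx0 linear0 tensor_op0 mulmx0.
- rewrite tensor_opD mulmxDr -IHs -IHs' -linearD -mulmxDr.
  by rewrite /tens13 -linearD.
rewrite tens12E tens13E !tensmx_mul mulmx1 mul1mx partial_trace23E.
by rewrite !tensor_opE -scalemxAl -scalemxAr scalerA.
Qed.

Lemma partial_trace23_23_12 (F : fieldType) (N : nat) (t s : 'M[F]_(N * N))
    (X Y : 'M[F]_N) :
  partial_trace23 X Y (tens23 s *m tens12 t)
  = tensor_op t (X *m tensor_op s Y).
Proof.
elim/tensmx_ind: t => [|t t' IHt IHt'|x y].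
- by rewrite /tens12 linear0 mulmx0 linear0 tensor_op0.
- rewrite tensor_opD -IHt -IHt' -linearD -mulmxDr.
  by rewrite /tens12 -linearD.
elim/tensmx_ind: s => [|s s' IHs IHs'|x' y'].
- by rewrite /tens23 linear0 mul0mx linear0 tensor_op0 mulmx0 linear0.
- rewrite tensor_opD mulmxDr [RHS]linearD /= -IHs -IHs' -linearD -mulmxDl.
  by rewrite /tens23 -linearD.
rewrite tens12E tens23E !tensmx_mul mulmx1 mul1mx partial_trace23E.
rewrite !tensor_opE -!scalemxAr mxtraceZ mulrC -mulmxA.
by rewrite (mxtrace_mulC x') mulmxA.
Qed.

Lemma partial_trace23_13_23 (F : fieldType) (N : nat) (t s : 'M[F]_(N * N))
    (X Y : 'M[F]_N) :
  partial_trace23 X Y (tens13 t *m tens23 s)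
  = tensor_op t (tensor_op (tens21 s) X *m Y).
Proof.
elim/tensmx_ind: t => [|t t' IHt IHt'|x y].
- by rewrite /tens13 linear0 mul0mx linear0 tensor_op0.
- rewrite tensor_opD -IHt -IHt' -linearD -mulmxDl.
  by rewrite /tens13 -linearD.
elim/tensmx_ind: s => [|s s' IHs IHs'|x' y'].
- rewrite /tens23 linear0 mulmx0 linear0.
  by rewrite /tens21 linear0 tensor_op0 mul0mx linear0.
- rewrite /tens21 linearD -!/(tens21 _) tensor_opD mulmxDl [RHS]linearD.
  by rewrite /= -IHs -IHs' -linearD -mulmxDr /tens23 -linearD.
rewrite tens13E tens23E tens21E !tensmx_mul mulmx1 !mul1mx partial_trace23E.
by rewrite !tensor_opE -scalemxAl -scalemxAr mxtraceZ mulmxA.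
Qed.

(** Every linear form on A is x |-> tr(x X) for a unique X, so the map
xi |-> (xi (x) id)(t) is the operator attached to the flip of t. *)
Lemma nondegenerate_tensor_inj (F : fieldType) (N : nat) (t : 'M[F]_(N * N)) :
  nondegenerate_tensor t -> injective (tensor_op (tens21 t)).
Proof.
move=> /bij_inj tinj X Y.
pose pairing (Z : 'M[F]_N) (x : 'M[F]_N) : F^o := \tr (x *m Z).
have plin Z : linear (pairing Z).
  by move=> a x y; rewrite /pairing mulmxDl -scalemxAl mxtraceD mxtraceZ.
pose L Z := GRing.isLinear.Build _ _ _ _ (pairing Z) (plin Z).
pose xi Z : {linear _ -> _} := HB.pack (pairing Z) (L Z).
have E Z : tlift (fun x y => (linfun (xi Z) x : F) *: y) t
    = tensor_op (tens21 t) Z.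
  elim/tensmx_ind: t {tinj} => [|t s IHt IHs|x y].
  - by rewrite /tens21 !linear0 tensor_op0.
  - by rewrite [LHS]linearD [LHS]/= IHt IHs /tens21 [in RHS]linearD tensor_opD.
  - rewrite tens21E tensor_opE.
    rewrite (@tlift_tens F N 'M[F]_N (fun x y => (linfun (xi Z) x : F) *: y)).
    + by rewrite lfunE.
    + by move=> v a u w; rewrite linearP scalerDl scalerA.
    + by move=> v a u w; rewrite scalerDr !scalerA mulrC.
rewrite -!E => /tinj/lfunP xiE; apply/matrixP => i j.
by have := xiE (delta_mx j i); rewrite !lfunE /= /pairing !mxtrace_mul_delta.
Qed.

(** The associative Yang-Baxter equation on operators: for p = r(x), q = r(y),
s = r(x + y) and t = r(-x), the first hypothesis is unitarity at x. *)
Lemma AYBE_tensor_op (F : fieldType) (N : nat) (p q s t : 'M[F]_(N * N)) :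
  tens21 t = - p ->
  tens12 p *m tens13 q - tens23 q *m tens12 s + tens13 s *m tens23 t = 0 ->
  forall X Y, tensor_op p X *m tensor_op q Y
    = tensor_op s (X *m tensor_op q Y + tensor_op p X *m Y).
Proof.
move=> tp ybe X Y; have := congr1 (partial_trace23 X Y) ybe.
rewrite linearD linearB linear0 /= partial_trace23_12_13.
rewrite partial_trace23_23_12 partial_trace23_13_23 tp tensor_opN mulNmx.
by rewrite linearN -addrA -opprD -linearD => /eqP; rewrite subr_eq0 => /eqP.
Qed.

(** Passing to inverses turns that relation into the Leibniz rule. *)
Lemma Rota_Baxter_inverse (F : fieldType) (N : nat)
    (P P' Q Q' T T' : 'M[F]_N -> 'M[F]_N) :
  cancel P' P -> cancel Q' Q -> cancel T T' ->
  (forall X Y, P X *m Q Y = T (X *m Q Y + P X *m Y)) ->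
  forall X Y, T' (X *m Y) = P' X *m Y + X *m Q' Y.
Proof.
move=> PK QK TK PQT X Y; apply: (canLR TK).
by have := PQT (P' X) (Q' Y); rewrite PK QK.
Qed.

(** * Derivations of the matrix algebra *)

(** A derivation delta is ad b for b = sum_i delta(e_i0) e_0i; subtracting
tr(b)/N from b makes it traceless. *)
Lemma derivation_inner (F : fieldType) (N : nat) (delta : 'End('M[F]_N)) :
  (0 < N)%N -> N%:R != 0 :> F ->
  (forall S T, delta (S *m T) = delta S *m T + S *m delta T) ->
  exists2 a : 'M[F]_N, \tr a = 0 & forall S, delta S = a *m S - S *m a.
Proof.
case: N delta => // n delta _ n0 dM.
pose b : 'M[F]_n.+1 := \sum_i delta (delta_mx i ord0) *m delta_mx ord0 i.
have bE S : delta S = b *m S - S *m b.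
  have -> : S *m b = b *m S - delta S.
    rewrite /b mulmx_sumr mulmx_suml.
    under eq_bigr => i _.
      rewrite mulmxA (_ : S *m _ = delta (S *m delta_mx i ord0) -
        delta S *m delta_mx i ord0); last by rewrite dM addrAC subrr add0r.
      rewrite mulmxBl -[X in _ - X]mulmxA mul_delta_mx.
      over.
    rewrite /= sumrB -mulmx_sumr; congr (_ - _); last first.
      rewrite -[RHS]mulmx1; congr (_ *m _).
      apply/matrixP => i j; rewrite summxE (bigD1 i) //=.
      rewrite [X in _ + X]big1 ?addr0.
        by rewrite !mxE eqxx eq_sym.
      by move=> k /negPf nk; rewrite mxE eq_sym nk.
    have colE (i : 'I_n.+1) : S *m (delta_mx i ord0 : 'M[F]_n.+1)
        = \sum_j S j i *: delta_mx j ord0.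
      apply/matrixP => p q; rewrite mxE (bigD1 i) //=.
      rewrite [X in _ + X]big1 ?addr0; last first.
        by move=> k /negPf nk; rewrite mxE nk mulr0.
      rewrite summxE (bigD1 p) //= [X in _ + X]big1 ?addr0; last first.
        by move=> k /negPf nk; rewrite !mxE eq_sym nk mulr0.
      by rewrite !mxE !eqxx.
    have rowE (j : 'I_n.+1) : (delta_mx ord0 j : 'M[F]_n.+1) *m S
        = \sum_i S j i *: delta_mx ord0 i.
      apply/matrixP => p q; rewrite mxE (bigD1 j) //=.
      rewrite [X in _ + X]big1 ?addr0; last first.
        by move=> k /negPf nk; rewrite mxE nk andbF mul0r.
      rewrite summxE (bigD1 q) //= [X in _ + X]big1 ?addr0; last first.
        by move=> k /negPf nk; rewrite !mxE [q == k]eq_sym nk andbF mulr0.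
      by rewrite !mxE !eqxx andbT mulrC.
    transitivity (\sum_i \sum_j
        delta (delta_mx j ord0) *m (S j i *: delta_mx ord0 i)).
      apply: eq_bigr => i _; rewrite colE linear_sum mulmx_suml.
      by apply: eq_bigr => j _; rewrite linearZ /= -scalemxAl -scalemxAr.
    rewrite exchange_big; apply: eq_bigr => j _ /=.
    by rewrite -mulmxA rowE mulmx_sumr.
  by rewrite opprB addrC subrK.
exists (b - (\tr b / n.+1%:R)%:M).
  rewrite mxtraceD linearN /= mxtrace_scalar.
  by rewrite -[_ / _ *+ _]mulr_natr mulfVK // subrr.
move=> S; rewrite bE mulmxBl mulmxBr mul_scalar_mx mul_mx_scalar.
by rewrite opprB addrA subrK.
Qed.

Lemma commute_delta_scalar (F : fieldType) (n : nat) (M : 'M[F]_n.+1) :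
  (forall S, S *m M = M *m S) -> M = (M 0 0)%:M.
Proof.
move=> MC; apply/matrixP => p i.
have := congr1 (fun A : 'M[F]_n.+1 => A p 0) (MC (delta_mx i 0)).
rewrite !mxE (bigD1 0) //= big1 ?addr0; last first.
  by move=> k /negPf k0; rewrite !mxE k0 andbF mul0r.
rewrite (bigD1 i) //= big1 ?addr0; last first.
  by move=> k /negPf ki; rewrite !mxE ki mulr0.
by rewrite !mxE !eqxx mulr1 andbT mulr_natl => <-.
Qed.

(** A family of operators satisfying the Leibniz rule with a parameter is
D_u = f(u) + ad a. The radius is halved in the last clause so that the
difference of two parameters stays in the domain of the rule. *)
Lemma twisted_derivation (K : numFieldType) (n : nat)
    (D : K -> 'End('M[K]_n.+1)) (e : K) :
  0 < e ->
  (forall x y, x != 0 -> y != 0 -> x + y != 0 ->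
     `|x| < e -> `|y| < e -> `|x + y| < e ->
     forall S T, D (x + y) (S *m T) = D x S *m T + S *m D y T) ->
  exists (f : K -> K) (a : 'M[K]_n.+1),
  [/\ \tr a = 0,
      forall x y, x != 0 -> y != 0 -> x + y != 0 ->
        `|x| < e -> `|y| < e -> `|x + y| < e -> f (x + y) = f x + f y,
      forall u, u != 0 -> `|u| < e -> D u 1%:M = (f u)%:M &
      forall u, u != 0 -> `|u| < e / 2 ->
        forall S, D u S = f u *: S + (a *m S - S *m a)].
Proof.
move=> e0 DM; pose f u := D u 1%:M 0 0.
have hlt (u : K) : `|u| < e -> `|u / 2| < e.
  by move=> ue; rewrite normrM normfV normr_nat (le_lt_trans _ ue) //
    ler_piMr // invf_le1 // ler1n.
(* With S = 1 or T = 1 and the parameters u and - u / 2 in both orders, the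
   rule computes D (u / 2) S in two ways, which differ by D u 1 on the two
   sides of S. *)
have D1 u : u != 0 -> `|u| < e -> D u 1%:M = (f u)%:M.
  move=> u0 ue; apply: commute_delta_scalar => S.
  have h0 : u / 2 != 0 by rewrite mulf_neq0 // invr_neq0.
  have hN : - (u / 2) + u = u / 2 by rewrite {2}(splitr u) addKr.
  have := DM (- (u / 2)) u; rewrite hN oppr_eq0 normrN.
  move=> /(_ h0 u0 h0 (hlt _ ue) ue (hlt _ ue) S 1%:M).
  have := DM u (- (u / 2)); rewrite addrC hN oppr_eq0 normrN.
  move=> /(_ u0 h0 h0 ue (hlt _ ue) (hlt _ ue) 1%:M S).
  by rewrite !mulmx1 !mul1mx => -> /eqP; rewrite addrC (inj_eq (addrI _))
    => /eqP ->.
have fD x y : x != 0 -> y != 0 -> x + y != 0 ->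
    `|x| < e -> `|y| < e -> `|x + y| < e -> f (x + y) = f x + f y.
  move=> x0 y0 xy0 xe ye xye.
  have := congr1 (fun A : 'M[K]_n.+1 => A 0 0)
    (DM _ _ x0 y0 xy0 xe ye xye 1%:M 1%:M).
  by rewrite !mulmx1 mul1mx mxE.
(* D u - f u does not depend on u, so it is read off at one point. *)
pose u0 := e / 4; have u0_gt0 : 0 < u0 by rewrite divr_gt0.
have u0_neq0 : u0 != 0 by rewrite gt_eqF.
pose delta : 'End('M[K]_n.+1) := D u0 - f u0 *: \1%VF.
have he : e / 2 < e by rewrite ltr_pdivrMr // ltr_pMr // ltr1n.
have u0e : `|u0| < e / 2.
  by rewrite gtr0_norm // ltr_pM2l // ltf_pV2 ?posrE // ltr_nat.
have DE u S : u != 0 -> `|u| < e / 2 -> D u S = f u *: S + delta S.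
  move=> un0 ue; rewrite /delta add_lfunE opp_lfunE scale_lfunE id_lfunE.
  have [->|/eqP nu] := eqVneq u u0; first by rewrite addrC subrK.
  have y0 : u - u0 != 0 by rewrite subr_eq0; apply/eqP.
  have ye : `|u - u0| < e.
    by rewrite (le_lt_trans (ler_normB _ _)) // [e]splitr ltrD.
  have uE : u0 + (u - u0) = u by rewrite addrC subrK.
  have := DM u0 (u - u0); have := fD u0 (u - u0); rewrite uE.
  move=> /(_ u0_neq0 y0 un0 (lt_trans u0e he) ye (lt_trans ue he)) ->.
  move=> /(_ u0_neq0 y0 un0 (lt_trans u0e he) ye (lt_trans ue he) S 1%:M).
  rewrite !mulmx1 D1 // mul_mx_scalar => ->.
  by rewrite scalerDl [RHS]addrC addrA subrK.
have dM S T : delta (S *m T) = delta S *m T + S *m delta T.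
  have h0 : u0 / 2 != 0 by rewrite mulf_neq0 // invr_neq0.
  have u0e' := lt_trans u0e he.
  have h2 : `|u0 / 2| < e / 2.
    by rewrite (le_lt_trans _ u0e) // normrM normfV normr_nat ler_piMr //
      invf_le1 // ler1n.
  have := DM (u0 / 2) (u0 / 2); have := fD (u0 / 2) (u0 / 2).
  rewrite -splitr.
  move=> /(_ h0 h0 u0_neq0 (hlt _ u0e') (hlt _ u0e') u0e') fE.
  move=> /(_ h0 h0 u0_neq0 (hlt _ u0e') (hlt _ u0e') u0e' S T).
  rewrite !DE // fE mulmxDl mulmxDr -scalemxAl -scalemxAr scalerDl.
  by rewrite [RHS]addrACA => /addrI.
have nK : n.+1%:R != 0 :> K by rewrite pnatr_eq0.
have [a tra da] := derivation_inner (ltn0Sn n) nK dM.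
by exists f, a; split=> // u un0 ue S; rewrite DE // da.
Qed.

(** * Additive functions with a complex derivative *)

Lemma Cplx_archimedean (R : realType) (x : Cplx R) :
  0 <= x -> exists n, x < n%:R.
Proof.
move=> x0; exists (Num.bound (complex.Re (x : R[i]))).
have [+ r0] : complex.Im (x : R[i]) = 0 /\ 0 <= complex.Re (x : R[i]).
  by move: x0; rewrite lecE /= => /andP[/eqP -> ->].
move=> i0; have -> m : (m%:R : Cplx R) = (m%:R : R)%:C%C.
  by rewrite rmorph_nat.
by rewrite ltcE /= i0 eqxx /= archi_boundP.
Qed.

Lemma near_within_ball0 (K : numFieldType) (P : K -> Prop) (b : K) :
  0 < b -> (\forall h \near (0 : K)^', P h) ->
  exists2 d : K, 0 < d & forall h, h != 0 -> `|h| < d -> P h /\ `|h| < b.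
Proof.
move=> b0; rewrite near_withinE => nP.
have /nbhs_norm0P[d /= d0 dP] :
    \forall h \near (0 : K), (h != 0 -> P h) /\ `|h| < b.
  have lt_b : \forall h \near (0 : K), `|h| < b by apply/nbhs_norm0P; exists b.
  by move: nP lt_b; apply: filterS2 => h nPh hb; split.
by exists d => // h h0 /dP[/(_ h0)].
Qed.

(** A function that is additive near 0 and has a complex derivative at one point
is linear: its difference quotient at u0 is f(h) / h, and f(h) / h takes the
same value at h = u / 2 ^ n for all n. *)
Lemma additive_derivable_linear (R : realType) (f : Cplx R -> (Cplx R)^o)
    (e u0 : Cplx R) :
  (forall x y, x != 0 -> y != 0 -> x + y != 0 ->
    `|x| < e -> `|y| < e -> `|x + y| < e -> f (x + y) = f x + f y) ->
  u0 != 0 -> `|u0| < e -> derivable (f : (Cplx R)^o -> (Cplx R)^o) u0 1 ->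
  exists c, forall u, u != 0 -> `|u| < e -> f u = c * u.
Proof.
move=> fD u00 u0e /cvg_ex[/= c fc]; exists c => u u1 ue.
have half n : f (u / 2 ^+ n) = f u / 2 ^+ n /\ `|u / 2 ^+ n| < e.
  elim: n => [|n [IH IHe]]; first by rewrite expr0 !divr1.
  set z := u / 2 ^+ n.+1.
  have zz : z + z = u / 2 ^+ n.
    by rewrite /z exprS invfM mulrCA [2^-1 * _]mulrC -splitr.
  have z0 : z != 0 by rewrite mulf_neq0 // invr_neq0 // expf_neq0.
  have ze : `|z| < e.
    apply: le_lt_trans IHe; rewrite -zz -mulr2n normrMn mulr2n.
    by rewrite lerDl.
  split=> //; have := fD z z z0 z0; rewrite zz IH => /(_ _ ze ze IHe) E.
  have {}E : f u / 2 ^+ n = f z + f z.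
    by apply: E; rewrite mulf_neq0 // invr_neq0 // expf_neq0.
  by rewrite exprS invfM mulrCA E -mulr2n -[f z *+ 2]mulr_natl mulKf.
apply/eqP/negPn/negP => neq.
have eps0 : 0 < `|c - f u / u|.
  rewrite normr_gt0 subr_eq0; apply: contra neq => /eqP ->.
  by rewrite mulfVK.
move/cvgrPdist_lt: fc => /(_ _ eps0)/(near_within_ball0 ltr01)[d d0 dP].
(* For 2 ^ n > |u| m, the point u / 2 ^ n is closer to 0 than d, |u0| and
   e - |u0|. *)
pose m := d^-1 + `|u0|^-1 + (e - `|u0|)^-1.
have eu0 : 0 < e - `|u0| by rewrite subr_gt0.
have nu0 : 0 < `|u0| by rewrite normr_gt0.
have m_ge0 : 0 <= `|u| * m.
  by rewrite mulr_ge0 // !addr_ge0 // invr_ge0 ltW.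
have [n nP] := Cplx_archimedean m_ge0.
have small k : 0 < k -> k^-1 <= m -> `|u / 2 ^+ n| < k.
  move=> k0 km; rewrite normrM normfV normrX normr_nat.
  rewrite ltr_pdivrMr ?exprn_gt0 // mulrC -ltr_pdivrMr //.
  apply: (@le_lt_trans _ _ (`|u| * m)); first by rewrite ler_wpM2l.
  by apply: lt_trans nP _; rewrite -natrX ltr_nat ltn_expl.
have vd : 0 <= d^-1 by rewrite invr_ge0 ltW.
have vu : 0 <= `|u0|^-1 by rewrite invr_ge0 ltW.
have ve : 0 <= (e - `|u0|)^-1 by rewrite invr_ge0 ltW.
have hd : `|u / 2 ^+ n| < d.
  by apply: small => //; rewrite /m -addrA lerDl addr_ge0.
have hu : `|u / 2 ^+ n| < `|u0|.
  by apply: small => //; rewrite /m addrAC lerDr addr_ge0.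
have he : `|u / 2 ^+ n| < e - `|u0|.
  by apply: small => //; rewrite /m lerDr addr_ge0.
have h0 : u / 2 ^+ n != 0 by rewrite mulf_neq0 // invr_neq0 // expf_neq0.
have [+ _] := dP _ h0 hd; rewrite /= [_%:A]mulr1 fD //.
- rewrite addrK (half n).1 [_ *: _]mulrC -mulf_div divff ?divr1 ?mulr1 ?ltxx //.
- apply: contraTneq hu => /eqP; rewrite addr_eq0 => /eqP ->.
  by rewrite normrN ltxx.
- exact: (half n).2.
- by apply: le_lt_trans (ler_normD _ _) _; rewrite -ltrBrDr.
Qed.

(** * Derivability of meromorphic matrices *)

Lemma meromorphic_at0_derivable (R : realType) (f : Cplx R -> Cplx R) :
  meromorphic_at f 0 ->
  \forall w \near (0 : Cplx R)^',
    derivable (f : (Cplx R)^o -> (Cplx R)^o) w 1.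
Proof.
move=> [k [g [dg fE]]].
have {}fE : \forall w \near (0 : Cplx R), w != 0 -> f w = w ^- k * g w.
  move: fE; rewrite near_withinE; apply: filterS => w wP /wP ->.
  by rewrite subr0.
rewrite near_withinE.
move: dg (near_join fE); apply: filterS2 => w dgw fEw w0.
have near0 : \forall v \near w, v != 0.
  apply/nbhs_normP; exists `|w|; first by rewrite /= normr_gt0.
  move=> v /=; apply: contraTneq => ->; rewrite subr0 ltxx //.
pose F : (Cplx R)^o -> (Cplx R)^o := fun v => v ^- k.
have dF : derivable F w 1.
  apply: (@derivableV _ _ (fun v : (Cplx R)^o => v ^+ k)).
    by rewrite expf_neq0.
  exact: exprn_derivable.
have dFg : derivable (F * g) w 1 := derivableM dF dgw.
apply: near_eq_derivable dFg.
by move: near0 fEw; apply: filterS2 => v v0 /(_ v0) ->.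
Qed.

Lemma meromorphic_near0_derivable (R : realType) (m n : nat)
    (r : Cplx R -> 'M[Cplx R]_(m, n)) :
  meromorphic_near0 r ->
  \forall w \near (0 : Cplx R)^', forall i j,
    derivable ((fun u => r u i j) : (Cplx R)^o -> (Cplx R)^o) w 1.
Proof.
move=> r_mero; apply: filter_forall => i; apply: filter_forall => j.
exact: meromorphic_at0_derivable (nbhs_singleton (r_mero i j)).
Qed.

Lemma derivable_big_sum (K : numFieldType) (m : nat) (h : 'I_m -> K^o -> K^o)
    (w : K^o) :
  (forall i, derivable (h i) w 1) -> derivable (fun u => \sum_i h i u) w 1.
Proof.
move=> dh; rewrite (_ : (fun u => _) = \sum_i h i); first exact: derivable_sum.
by apply/funext => u; rewrite fct_sumE.
Qed.

Lemma derivable_mx_form (K : numFieldType) (m n : nat)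
    (r : K^o -> 'M[K]_(m, n)) (L : 'M[K]_(m, n) -> K) (w : K^o) :
  (forall a A B, L (a *: A + B) = a * L A + L B) ->
  (forall i j, derivable ((fun u => r u i j) : K^o -> K^o) w 1) ->
  derivable ((fun u => L (r u)) : K^o -> K^o) w 1.
Proof.
move=> Llin dr.
pose LH := GRing.isLinear.Build _ _ _ _ (L : _ -> K^o) Llin.
pose LL : {linear 'M[K]_(m, n) -> K^o} := HB.pack (L : _ -> K^o) LH.
have LE A : L A = \sum_i \sum_j A i j * L (delta_mx i j).
  rewrite -[LHS]/(LL A) {1}(matrix_sum_delta A) linear_sum.
  apply: eq_bigr => i _; rewrite linear_sum; apply: eq_bigr => j _.
  by rewrite linearZ.
have -> : (fun u => L (r u) : K^o) =
    (fun u => \sum_i \sum_j r u i j * L (delta_mx i j)).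
  by apply/funext => u; rewrite LE.
apply: derivable_big_sum => i; apply: derivable_big_sum => j.
exact: (derivableM (dr i j) (derivable_cst (L (delta_mx i j) : K^o) w 1)).
Qed.

(** * Unitary solutions *)

Unset Implicit Arguments.

Theorem proposition1p1 (R : realType) (N : nat) (hN : (0 < N)%N)
    (r : Cplx R -> 'M[Cplx R]_(N * N))
    (r_mero : meromorphic_near0 r)
    (r_nondeg : generically_nondegenerate r)
    (r_unitary : unitary_rmatrix r)
    (r_AYBE : associative_YBE r) :
  exists (c : Cplx R) (a : 'M[Cplx R]_N),
    [/\ c != 0, \tr a = 0 &
      \forall u \near (0 : Cplx R)^',
        exists2 phi : 'End('M[Cplx R]_N),
          is_phi a (c * u) phi & r u = tens_map_l phi (tensP (Cplx R) N)].
Proof.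
case: N hN r r_mero r_nondeg r_unitary r_AYBE => // n _ r r_mero r_nondeg
  r_unitary r_AYBE.
have [e e0 eP] : exists2 e : Cplx R, 0 < e &
    forall x : Cplx R, x != 0 -> `|x| < e ->
    [/\ nondegenerate_tensor (r x), tens21 (r (- x)) = - r x,
        forall i j,
          derivable ((fun u => r u i j) : (Cplx R)^o -> (Cplx R)^o) x 1 &
        forall y, y != 0 -> `|y| < e -> x + y != 0 ->
        tens12 (r (- y)) *m tens13 (r (x + y))
        - tens23 (r (x + y)) *m tens12 (r x)
        + tens13 (r x) *m tens23 (r y) = 0].
  (* One radius serves all four hypotheses. *)
  move: r_AYBE => /nbhs_ballP[d /= d0 dP].
  have [e e0 eP] := near_within_ball0 d0 (filterI r_nondeg
    (filterI r_unitary (meromorphic_near0_derivable r_mero))).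
  exists e => // x x0 xe; have [[nd [un dr]] xd] := eP x x0 xe.
  split=> // y y0 ye xy0; have [_ yd] := eP y y0 ye.
  by apply: (dP (x, y)) => //; split; rewrite /ball /= sub0r normrN.
(* By unitarity, the operator attached to the flip of r(-u) is minus the
   operator of r(u). *)
have inj_phi u : u != 0 -> `|u| < e -> lker (tensor_op (r u)) == 0%VS.
  move=> u0 ue.
  have ue' : `|- u| < e by rewrite normrN.
  have nu0 : - u != 0 by rewrite oppr_eq0.
  have [nd _ _ _] := eP (- u) nu0 ue'; have [_ un _ _] := eP u u0 ue.
  apply/lker0P => X Y XY; apply: (nondegenerate_tensor_inj nd).
  by rewrite un !tensor_opN XY.
pose D u := (tensor_op (r u))^-1%VF.
have DK u : u != 0 -> `|u| < e -> cancel (tensor_op (r u)) (D u).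
  by move=> u0 ue; apply/lker0_lfunK/inj_phi.
have KD u : u != 0 -> `|u| < e -> cancel (D u) (tensor_op (r u)).
  by move=> u0 ue; apply/lker0_lfunVK/inj_phi.
have DM x y : x != 0 -> y != 0 -> x + y != 0 ->
    `|x| < e -> `|y| < e -> `|x + y| < e ->
    forall S T, D (x + y) (S *m T) = D x S *m T + S *m D y T.
  move=> x0 y0 xy0 xe ye xye.
  have xe' : `|- x| < e by rewrite normrN.
  have [_ un _ _] := eP x x0 xe.
  (* The equation at the parameters x + y and - x, whose sum is y. *)
  have [_ _ _ /(_ (- x))] := eP (x + y) xy0 xye.
  have -> : x + y - x = y by rewrite addrAC subrr add0r.
  rewrite oppr_eq0 opprK => /(_ x0 xe' y0)/(AYBE_tensor_op un).
  exact: Rota_Baxter_inverse (KD x x0 xe) (KD y y0 ye) (DK _ xy0 xye).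
have [f [a [tra fD D1 DE]]] := twisted_derivation e0 DM.
pose u0 := e / 2.
have u0_neq0 : u0 != 0 by rewrite gt_eqF // divr_gt0.
have u0e : `|u0| < e.
  by rewrite gtr0_norm ?divr_gt0 // ltr_pdivrMr // ltr_pMr // ltr1n.
(* A matrix coefficient of phi_u(1) = f(u)^-1 1. *)
pose g u := tensor_op (r u) 1%:M 0 0.
have fg u : u != 0 -> `|u| < e -> f u * g u = 1.
  move=> un0 ue.
  have := KD u un0 ue 1%:M; rewrite D1 //.
  rewrite -[(f u)%:M]scalemx1 linearZ /=.
  move=> /(congr1 (fun A : 'M[Cplx R]_n.+1 => A 0 0)).
  by rewrite !mxE eqxx.
have df : derivable (f : (Cplx R)^o -> (Cplx R)^o) u0 1.
  have dg : derivable (g : (Cplx R)^o -> (Cplx R)^o) u0 1.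
    have [_ _ dr _] := eP u0 u0_neq0 u0e.
    apply: (derivable_mx_form (r := r)
      (L := fun t => tensor_op t 1%:M 0 0)) dr.
    by move=> b A B; rewrite !lfunE /= /partial_trace linearP !mxE.
  have gn0 : g u0 != 0.
    apply: contra_eq_neq (fg _ u0_neq0 u0e) => ->.
    by rewrite mulr0 eq_sym oner_eq0.
  apply: near_eq_derivable (derivableV gn0 dg).
  have nz : \forall u \near u0, u != 0.
    apply/nbhs_normP; exists `|u0|; first by rewrite /= normr_gt0.
    by move=> v /=; apply: contraTneq => ->; rewrite subr0 ltxx.
  have lt : \forall u \near u0, `|u| < e.
    apply/nbhs_normP; exists (e - `|u0|); first by rewrite /= subr_gt0.
    move=> v /= h; rewrite -(subrK u0 v) (le_lt_trans (ler_normD _ _)) //.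
    by rewrite -ltrBrDr distrC.
  move: nz lt; apply: filterS2 => u un0 ue.
  have gu : g u != 0.
    apply: contra_eq_neq (fg _ un0 ue) => ->.
    by rewrite mulr0 eq_sym oner_eq0.
  by rewrite -[LHS]mul1r -(fg _ un0 ue) mulfK.
have [c fE] := additive_derivable_linear fD u0_neq0 u0e df.
exists c, a; split => //.
  have : f u0 * g u0 != 0 by rewrite fg // oner_eq0.
  by apply: contraNneq => c0; rewrite fE // c0 !mul0r.
have e2 : 0 < e / 2 by rewrite divr_gt0.
near=> u.
have un0 : u != 0 by near: u; exact: nbhs_dnbhs_neq.
have ue2 : `|u| < e / 2 by near: u; exact: dnbhs0_lt.
have ue : `|u| < e.
  by rewrite (lt_trans ue2) // ltr_pdivrMr // ltr_pMr // ltr1n.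
exists (tensor_op (r u)); last by rewrite tens_map_l_tensor_op.
by move=> X; rewrite -fE // -DE // (DK _ un0 ue).
Unshelve. all: by end_near.
Qed.
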